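(* Let $n\geq 1$ be an integer, let $m=2n+1\geq 3$, let $\{x_j\}$ be a nondecreasing sequence of real numbers (knots), and let $j$ be an index such that $x_j,\ldots,x_{j+m}$ belong to the sequence and are uniform, i.e., for some real number $h>0$, $$ x_{j+k}=x_j+kh,\qquad k=1,2,\ldots,m. $$ Let $w^T_{j,m}$ and $w^H_{j,m}$ be the trigonometric and hyperbolic normalization weights, let $\rho_{i,a,b}$ be the coefficients of the $q$-binomial coefficients, and let $|\mathcal{S}_n|=\binom{2n-1}{n-1}$, all as defined in the context. (Trigonometric case) If $x_{i+m}-x_i<\pi$ for all $i$, then $$ w^T_{j,m}=\frac{1}{|\mathcal{S}_n|}\sum_{i=0}^{n(n-1)}\rho_{i,n-1,n}\cos\left(\frac{n^2-2i}{2}\,h\right). $$ (Hyperbolic case) Without any restriction on the knot distances, $$ w^H_{j,m}=\frac{1}{|\mathcal{S}_n|}\sum_{i=0}^{n(n-1)}\rho_{i,n-1,n}\cosh\left(\frac{n^2-2i}{2}\,h\right). $$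
   Context: For an integer $n\geq 1$, let $\mathcal{Q}_n$ be the set of vectors $\boldsymbol{q}=(q_1,\ldots,q_{2n})\in\mathbb{Z}^{2n}$ consisting of all permutations of $(1,2,\ldots,2n)$, so $|\mathcal{Q}_n|=(2n)!$. For $m=2n+1\geq 3$, the normalization weights are defined by $$ w^T_{j,m}=\frac{1}{|\mathcal{Q}_n|}\sum_{\boldsymbol{q}\in\mathcal{Q}_n}\prod_{k=1}^{n}\cos\left(\frac{x_{j+q_{2k}}-x_{j+q_{2k-1}}}{2}\right), \qquad w^H_{j,m}=\frac{1}{|\mathcal{Q}_n|}\sum_{\boldsymbol{q}\in\mathcal{Q}_n}\prod_{k=1}^{n}\cosh\left(\frac{x_{j+q_{2k}}-x_{j+q_{2k-1}}}{2}\right). $$ Let $\mathcal{S}_n$ be the set of vectors $\boldsymbol{s}=(s_1,\ldots,s_{2n-1})\in\{-1,1\}^{2n-1}$ consisting of all distinct permutations of the vector with $n-1$ entries equal to $-1$ and $n$ entries equal to $1$; thus $|\mathcal{S}_n|=\binom{2n-1}{n-1}$. The $q$-binomial (Gaussian) coefficients $\genfrac{[}{]}{0pt}{}{a+b}{a}_q$, for integers $a,b\geq 0$, are the polynomials in $q$ determined by $\genfrac{[}{]}{0pt}{}{b}{0}_q=\genfrac{[}{]}{0pt}{}{a}{a}_q=1$ and $$ \genfrac{[}{]}{0pt}{}{a+b}{a}_q=\genfrac{[}{]}{0pt}{}{a+b-1}{a-1}_q+q^a\genfrac{[}{]}{0pt}{}{a+b-1}{a}_q,\qquad a,b\geq 1.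 $$ The nonnegative integers $\rho_{i,a,b}$, $i=0,\ldots,ab$, are their coefficients: $$ \genfrac{[}{]}{0pt}{}{a+b}{a}_q=\sum_{i=0}^{ab}\rho_{i,a,b}\,q^i. $$ Equivalently, $\rho_{i,a,b}$ is the number of ways of throwing $i$ indistinguishable balls into $a$ indistinguishable bins, where each bin can contain up to $b$ balls. *)

(* Defs.v *)
From HB Require Import structures.
From mathcomp Require Import all_boot all_order all_algebra.
From mathcomp Require Import all_classical all_reals all_analysis.

Set Implicit Arguments.
Unset Strict Implicit.
Unset Printing Implicit Defensive.

Import Order.TTheory GRing.Theory Num.Theory.

Local Open Scope ring_scope.

Definition cosh (R : realType) (t : R) : R := (expR t + expR (- t)) / 2.

(* [permutations] lists the distinct permutations, each exactly once. *)
Definition Qset (n : nat) : seq (seq nat) := permutations (iota 1 (2 * n)).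

Definition Sset (n : nat) : seq (seq int) :=
  permutations (nseq n.-1 (-1) ++ nseq n 1).

(* [ent q i] is the 1-based entry q_i. *)
Definition ent (q : seq nat) (i : nat) : nat := nth 0%N q i.-1.

(* The weight of order m = 2n+1 at j: f is cos for w^T and cosh for w^H. *)
Definition weight (R : realType) (f : R -> R) (x : int -> R) (j : int)
    (n : nat) : R :=
  (size (Qset n))%:R^-1 *
  \sum_(q <- Qset n) \prod_(1 <= k < n.+1)
    f ((x (j + (ent q (2 * k))%:Z) - x (j + (ent q (2 * k).-1)%:Z)) / 2).

Definition wT (R : realType) (x : int -> R) (j : int) (n : nat) : R :=
  weight (@cos R) x j n.

Definition wH (R : realType) (x : int -> R) (j : int) (n : nat) : R :=
  weight (@cosh R) x j n.

(* [qbinom a b] is the Gaussian coefficient [a+b choose a]_q, not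
   [a choose b]_q; it is a polynomial in q = 'X with natural coefficients. *)
Fixpoint qbinom (a : nat) : nat -> {poly nat} :=
  if a is a'.+1 then
    fix qbinom_a (b : nat) : {poly nat} :=
      if b is b'.+1 then qbinom a' b + 'X^a * qbinom_a b' else 1
  else fun _ => 1.

Lemma qbinom0n b : qbinom 0 b = 1.
Proof. by []. Qed.

Lemma qbinomn0 a : qbinom a 0 = 1.
Proof. by case: a. Qed.

Lemma qbinomSS a b :
  qbinom a.+1 b.+1 = qbinom a b.+1 + 'X^(a.+1) * qbinom a.+1 b.
Proof. by []. Qed.

Definition rho (i a b : nat) : nat := ((qbinom a b)`_i)%R.

(* Main.v *)
(* Write f for cos or cosh. d'Alembert's equation f(s+t) + f(s-t) = 2 f(s) f(t)
   turns the product of the f(q_2k - q_(2k-1)), summed over all permutations,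
   into the sum of f(sum_k (q_2k - q_(2k-1))), because transposing q_2k and
   q_(2k-1) flips one sign and permutes the summands. The argument depends only
   on the set B = {q_2, q_4, .., q_2n}, which is equidistributed over the
   n-subsets of a 2n-set, and complementing B negates it; as f is even, one may
   assume that B contains the least element. The remaining (n-1)-subset of a
   (2n-1)-set has element sums counted by the Gaussian coefficient
   [2n-1 choose n-1]_q. *)
Require Import Defs.
From HB Require Import structures.
From mathcomp Require Import all_boot all_order all_algebra.
From mathcomp Require Import all_fingroup all_solvable zify ring lra.
From mathcomp Require Import all_classical all_reals all_analysis.

Set Implicit Arguments.
Unset Strict Implicit.
Unset Printing Implicit Defensive.

Import Order.TTheory GRing.Theory Num.Theory.

Local Open Scope ring_scope.

(** * Counting words, and averaging over permutations *)

(** Pascal's rule, by splitting on the first letter. This evaluates the size of [Sset n]. *)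
Lemma size_permutations_nseq (T : eqType) (u v : T) (a b : nat) : u != v ->
  size (permutations (nseq a u ++ nseq b v)) = 'C(a + b, a).
Proof.
move=> uv.
have const (w : T) k : size (permutations (nseq k w)) = 1%N.
  elim: k => [|k IH] //=.
  rewrite (perm_size (permutationsE _)) // size_allpairs_dep.
  have -> : undup (nseq k.+1 w) = [:: w].
    by elim: k {IH} => //= k ->; rewrite inE eqxx.
  by rewrite /= eqxx IH.
have [N] := ubnP (a + b)%N; elim: N a b => // N IH [|a] [|b] ltN.
- by rewrite /= bin0.
- by rewrite cat0s const bin0.
- by rewrite cats0 const addn0 binn.
have undup2 : perm_eq (undup (nseq a.+1 u ++ nseq b.+1 v)) [:: u; v].
  apply: uniq_perm; [exact: undup_uniq | by rewrite /= inE uv |] => w.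
  by rewrite mem_undup mem_cat !mem_nseq !inE.
rewrite (perm_size (permutationsE _)) // size_allpairs_dep sumnE big_map.
rewrite (perm_big _ undup2) /= !big_cons big_nil /= eqxx (negPf uv) addn0.
rewrite -[v :: nseq b v]/(nseq b.+1 v) IH; last by lia.
rewrite addSn binS addnC; congr addn.
have -> : rem v (nseq a u ++ nseq b.+1 v) = nseq a u ++ nseq b v.
  elim: a {ltN undup2} => [|a IHa] /=; first by rewrite eqxx.
  by rewrite (negPf uv) IHa.
by rewrite -[u :: _]/(nseq a.+1 u ++ nseq b v) IH ?addSn ?addnS //; lia.
Qed.

(** The symmetric group is [#|T|]-transitive, hence [#|A|]-transitive; this is applied to the
    enumerations of [A] and [B]. *)
Lemma imset_transitive (T : finType) (A B : {set T}) :
  #|A| = #|B| -> exists p : {perm T}, p @: A = B.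
Proof.
move=> eqAB.
have sizeB : size (enum B) == #|A| by rewrite -cardE eqAB.
have sizeA : size (enum A) == #|A| by rewrite -cardE.
have leAT : (#|A| <= #|T|)%N by rewrite max_card.
have dtup (C : {set T}) (sizeC : size (enum C) == #|A|) :
    Tuple sizeC \in #|A|.-dtuple([set: T]%SET).
  rewrite inE enum_uniq /=; apply/fintype.subsetP => z _; exact: finset.in_setT.
have [p _ /(congr1 val) /= tBA] :=
  atransP2 (ntransitive_weak leAT (Sym_trans T)) (dtup _ sizeA) (dtup _ sizeB).
exists p; apply/setP => z; rewrite -[in RHS]mem_enum tBA.
by apply/imsetP/mapP => -[w wA ->]; exists w; rewrite // ?mem_enum // -mem_enum.
Qed.

(** Double counting over pairs of a permutation [s] and a set [B] of the size of [O]: by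
    transitivity the sum over [s] is the same for every [B], while each fixed [s] permutes the sets
    of that size. The cross-multiplied form avoids division in [R]. *)
Lemma sum_imset_perm (R : nzRingType) (T : finType) (O : {set T})
    (G : {set T} -> R) :
  'C(#|T|, #|O|)%:R * (\sum_(s : {perm T}) G (s @: O)) =
  (#|T|)`!%:R * \sum_(B : {set T} | #|B| == #|O|) G B.
Proof.
have eqG (B : {set T}) : #|B| == #|O| ->
    \sum_(s : {perm T}) G (s @: O) = \sum_(s : {perm T}) G (s @: B).
  move=> /eqP /esym /imset_transitive [p pB].
  rewrite (reindex_inj (mulgI p)) /=; apply: eq_bigr => s _.
  by rewrite -pB -imset_comp; congr (G _); apply: eq_imset => z; rewrite /= permM.
rewrite -(card_draws T #|O|) -sum1_card natr_sum mulr_suml.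
rewrite (eq_bigr (fun B : {set T} => \sum_(s : {perm T}) G (s @: B))); last first.
  by move=> B; rewrite inE => /eqG ->; rewrite mul1r.
rewrite /= exchange_big /=.
transitivity (\sum_(s : {perm T}) \sum_(B : {set T} | #|B| == #|O|) G B).
  apply: eq_bigr => s _; rewrite [RHS](reindex_inj (imset_inj (@perm_inj _ s))).
  by apply: eq_bigl => B; rewrite inE card_imset //; exact: perm_inj.
suff <- : #|{: {perm T}}| = (#|T|)`!.
  by rewrite sumr_const [RHS]mulr_natl.
rewrite -(@cardsT T) -card_perm; apply: eq_card => s.
by rewrite [RHS]inE; apply/esym/fintype.subsetP => z; rewrite inE.
Qed.

(** * Element sums of subsets and Gaussian coefficients *)

Lemma ord0_notin_lift (N : nat) (A : {set 'I_N}) :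
  ord0 \notin [set lift ord0 i | i in A].
Proof. by apply/imsetP => -[i _ /eqP]; rewrite (negPf (neq_lift _ _)). Qed.

(** Once membership of [ord0] is known, [B] is recovered from its preimage under [lift ord0]. The
    equations are paired so that one rewrite rule serves both cases. *)
Lemma sum_split_ord0 (R : nmodType) (N : nat) (P : pred {set 'I_N.+1})
    (F : {set 'I_N.+1} -> R) :
  (\sum_(B | P B && (ord0 \in B)) F B =
    \sum_(A : {set 'I_N} | P (ord0 |: [set lift ord0 i | i in A]))
      F (ord0 |: [set lift ord0 i | i in A])) *
  (\sum_(B | P B && (ord0 \notin B)) F B =
    \sum_(A : {set 'I_N} | P [set lift ord0 i | i in A])
      F [set lift ord0 i | i in A]).
Proof.
have n0 := @ord0_notin_lift N.
have preK (A : {set 'I_N}) :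
    lift ord0 @^-1: [set lift ord0 i | i in A] = A.
  by apply/setP => i; rewrite inE mem_imset //; exact: lift_inj.
have preK1 (A : {set 'I_N}) :
    lift ord0 @^-1: (ord0 |: [set lift ord0 i | i in A]) = A.
  by apply/setP => i; rewrite !inE mem_imset //=; exact: lift_inj.
have imK (B : {set 'I_N.+1}) :
    [set lift ord0 i | i in lift ord0 @^-1: B] = B :\ ord0.
  apply/setP => i; rewrite !inE; case: (unliftP ord0 i) => [k|] ->.
    by rewrite mem_imset ?inE //; exact: lift_inj.
  by rewrite eqxx (negPf (n0 _)).
split.
  rewrite (reindex_onto (fun A : {set 'I_N} => ord0 |: [set lift ord0 i | i in A])
     (fun B => lift ord0 @^-1: B)) /=; last first.
    by move=> B /andP[_ B0]; rewrite imK finset.setD1K.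
  by apply: eq_bigl => A; rewrite preK1 eqxx finset.setU11 !andbT.
rewrite (reindex_onto (fun A : {set 'I_N} => [set lift ord0 i | i in A])
   (fun B => lift ord0 @^-1: B)) /=; last first.
  move=> B /andP[_ B0]; rewrite imK; apply/setP => i; rewrite !inE.
  by case: eqP => // ->; rewrite (negPf B0).
by apply: eq_bigl => A; rewrite preK eqxx n0 !andbT.
Qed.

Lemma card_lift0 (N : nat) (A : {set 'I_N}) :
  (#|[set lift ord0 i | i in A]| = #|A|) *
  (#|ord0 |: [set lift ord0 i | i in A]| = #|A|.+1).
Proof.
by rewrite cardsU1 ord0_notin_lift card_imset //; exact: lift_inj.
Qed.

Lemma sum_lift0 (N : nat) (A : {set 'I_N}) :
  (\sum_(i in [set lift ord0 i | i in A]) i = #|A| + \sum_(i in A) i)%N *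
  (\sum_(i in ord0 |: [set lift ord0 i | i in A]) i = #|A| + \sum_(i in A) i)%N.
Proof.
rewrite big_setU1 ?ord0_notin_lift //= big_imset /=; last by move=> ? ? _ _; apply: lift_inj.
by rewrite -sum1_card -big_split.
Qed.

Lemma sum_coefXnM (R : pzRingType) (p : {poly nat}) (m K : nat) (g : nat -> R) :
  (m <= K)%N ->
  \sum_(i < K) (('X^m * p)`_i)%R%:R * g i =
  \sum_(i < K - m) (p`_i)%R%:R * g (m + i)%N.
Proof.
move=> /subnKC; move: (K - m)%N => d <-.
rewrite big_split_ord /= big1 ?add0r => [|i _].
  by apply: eq_bigr => i _; rewrite coefXnM ltnNge leq_addr /= addKn.
by rewrite coefXnM ltn_ord mul0r.
Qed.

(** The recursion of [qbinom] mirrors the split on whether [ord0] lies in [A]: shifting the other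
    elements down by one lowers the sum by their number. The offset ['C(a, 2)] is the least possible
    sum, 0 + 1 + .. + (a - 1). Any [K] beyond the degree is allowed, so both inductive calls fit one
    range. *)
Lemma sum_subsets_rho (R : pzRingType) (a b K : nat) (G : nat -> R) :
  (a * b < K)%N ->
  \sum_(A : {set 'I_(a + b)} | #|A| == a) G (\sum_(i in A) i)%N =
  \sum_(i < K) (rho i a b)%:R * G ('C(a, 2) + i)%N.
Proof.
have [N] := ubnP (a + b)%N; elim: N a b K G => // N IH a b K G ltN.
have sum1 (g : nat -> R) K' : (0 < K')%N ->
    \sum_(i < K') ((1 : {poly nat})`_i)%R%:R * g i = g 0%N.
  case: K' => // K' _; rewrite big_ord_recl coef1 mul1r big1 ?addr0 // => i _.
  by rewrite coef1 mul0r.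
case: a ltN => [|a] ltN ltK.
  rewrite /rho qbinom0n (sum1 (fun i => G ('C(0, 2) + i)%N)) //.
  rewrite (big_pred1 finset.set0) ?big_set0 // => A /=; exact: cards_eq0.
case: b ltN ltK => [|b] ltN ltK.
  rewrite /rho qbinomn0 (sum1 (fun i => G ('C(a.+1, 2) + i)%N)); last by lia.
  rewrite (big_pred1 [set: 'I_(a.+1 + 0)]%SET); last first.
    move=> A /=; rewrite eqEcard finset.subsetT /= cardsT card_ord.
    have cA : (#|A| <= a.+1)%N.
      by apply: leq_trans (max_card _) _; rewrite card_ord addn0.
    by rewrite [X in _ = (X <= _)%N]addn0 eqn_leq cA.
  under eq_bigl do rewrite inE.
  by rewrite -(big_mkord xpredT id) bin2_sum !addn0.
rewrite (bigID (fun A : {set 'I_(a.+1 + b.+1)} => ord0 \in A)) /=.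
rewrite !sum_split_ord0.
under [X in X + _ = _]eq_bigl do rewrite card_lift0 eqSS.
under [X in X + _ = _]eq_bigr => A /eqP cA do rewrite sum_lift0 cA.
under [X in _ + X = _]eq_bigl do rewrite card_lift0.
under [X in _ + X = _]eq_bigr => A /eqP cA do rewrite sum_lift0 cA.
(* The factor ['X^(a.+1)] will use up the first [a.+1] indices of the range. *)
have ltK' : (a.+1 * b < K - a.+1)%N by lia.
have := IH a.+1 b (K - a.+1)%N (fun s => G (a.+1 + s)%N) ltac:(lia) ltK'.
rewrite addSnnS => eqN.
have eqY := IH a b.+1 K (fun s => G (a + s)%N) ltac:(lia) ltac:(lia).
apply: etrans (congr2 +%R eqY eqN) _.
rewrite /rho qbinomSS; under [RHS]eq_bigr do rewrite coefD natrD mulrDl.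
rewrite [RHS]big_split /= (sum_coefXnM _ (fun i => G ('C(a.+1, 2) + i)%N));
  last by lia.
by congr (_ + _); apply: eq_bigr => i _; congr (_ * G _); rewrite binS bin1; lia.
Qed.

(** * From products over permutations to sums over subsets *)

(* [c] accumulates the factors already merged into the argument of [f]; it must
   not see the transpositions that are still to be applied. *)
Lemma sum_perm_prod (R : realType) (f : R -> R) (T I : finType) (u : T -> R)
    (p : I * bool -> T) (c : {perm T} -> R) (r : seq I) :
  (forall s t, f (s + t) + f (s - t) = 2 * (f s * f t)) ->
  injective p -> uniq r ->
  (forall k s, k \in r -> c (tperm (p (k, true)) (p (k, false)) * s)%g = c s) ->
  \sum_(s : {perm T}) f (c s) *
     \prod_(k <- r) f (u (s (p (k, true))) - u (s (p (k, false)))) =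
  \sum_(s : {perm T})
     f (c s + \sum_(k <- r) (u (s (p (k, true))) - u (s (p (k, false))))).
Proof.
move=> fD pI; elim: r c => [|k r IH] c /=.
  by move=> _ _; apply: eq_bigr => s _; rewrite !big_nil mulr1 addr0.
move=> /andP[kr ur] cI.
pose d l (s : {perm T}) := u (s (p (l, true))) - u (s (p (l, false))).
have dk s : d k (tperm (p (k, true)) (p (k, false)) * s)%g = - d k s.
  by rewrite /d !permM tpermL tpermR opprB.
have neqp l m b1 b2 : m != l -> p (l, b1) != p (m, b2).
  by rewrite (inj_eq pI) xpair_eqE eq_sym => /negPf->.
have dl l m s : m != l -> d m (tperm (p (l, true)) (p (l, false)) * s)%g = d m s.
  by move=> ml; rewrite /d !permM !tpermD // neqp.
have neqk l : l \in r -> l != k by apply: contraTneq => ->.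
transitivity (\sum_(s : {perm T}) f (c s + d k s) * \prod_(l <- r) f (d l s)).
  (* Double the right side and reindex one copy by the transposition: it negates [d k] and fixes [c]
     and the other differences, so d'Alembert's equation applies termwise. *)
  apply: (@mulfI _ 2); first by rewrite pnatr_eq0.
  rewrite [RHS]mulr_natl mulr2n.
  rewrite [X in _ = X + _]
    (reindex_inj (mulgI (tperm (p (k, true)) (p (k, false))))) /=.
  rewrite -big_split mulr_sumr /=; apply: eq_bigr => s _.
  rewrite big_cons -/(d k s) dk cI ?mem_head //.
  under [X in _ = _ * X + _]eq_big_seq => l lr do rewrite dl ?neqk //.
  by rewrite -mulrDl addrC fD !mulrA.
rewrite (IH (fun s => c s + d k s)) //; last first.
  by move=> l s lr; rewrite dl ?cI ?in_cons ?lr ?orbT // eq_sym neqk.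
by apply: eq_bigr => s _; rewrite big_cons [in RHS]addrA.
Qed.

(** Passing from lists to the group ['S_N] makes reindexing by transpositions available. *)
Lemma sum_permutations_iota (R : nmodType) (N : nat) (F : seq nat -> R) :
  \sum_(q <- permutations (iota 1 N)) F q =
  \sum_(s : 'S_N) F [seq (s i).+1 | i <- enum 'I_N].
Proof.
pose word (s : 'S_N) := [seq (s i).+1 | i <- enum 'I_N].
have wordI : injective word.
  by move=> s t /eq_in_map st; apply/permP => i; apply/val_inj/succn_inj/st;
    rewrite mem_enum.
suff -> : \sum_(q <- permutations (iota 1 N)) F q =
    \sum_(q <- [seq word s | s <- index_enum 'S_N]) F q by rewrite big_map.
apply: perm_big; apply: uniq_perm.
- exact: permutations_uniq.
- by rewrite map_inj_uniq // index_enum_uniq.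
move=> q; rewrite mem_permutations.
pose t := [tuple i.+1 | i < N].
have -> : iota 1 N = t.
  by rewrite /= -[1%N]addn0 iotaDl -val_enum_ord -map_comp.
have wordE (s : 'S_N) : [tuple tnth t (s i) | i < N] = word s :> seq nat.
  rewrite /word -val_ord_tuple; apply: eq_map => i.
  by rewrite tnth_mktuple.
apply/tuple_permP/mapP => [[s ->]|[s _ ->]]; exists s => //.
by rewrite mem_index_enum.
Qed.

(** The even-indexed minus the odd-indexed entries equals twice the even-indexed ones minus the
    total. With values counted from 0 the total is always ['C(2 * n, 2)], which gives the constant
    shift. *)
Lemma weight_subsets (R : realType) (f : R -> R) (x : int -> R) (j : int)
    (n : nat) (h : R) :
  (forall s t, f (s + t) + f (s - t) = 2 * (f s * f t)) -> f 0 = 1 ->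
  (forall k : nat, (1 <= k <= 2 * n)%N -> x (j + k%:Z) = x j + k%:R * h) ->
  weight f x j n = 'C(2 * n, n)%:R^-1 *
    \sum_(B : {set 'I_(2 * n)} | #|B| == n)
      f ((\sum_(i in B) i)%N%:R * h - 'C(2 * n, 2)%:R * h / 2).
Proof.
move=> fD f0 xE.
have ltp (kb : 'I_n * bool) : (2 * kb.1 + kb.2 < 2 * n)%N.
  by case: kb => -[k ltk] [] /=; lia.
(* With [k] and list positions counted from 0, [p (k, true)] is the position of q_(2k+2) and
   [p (k, false)] that of q_(2k+1). *)
pose p kb := Ordinal (ltp kb).
have pI : injective p.
  move=> [[k ltk] b] [[l ltl] c] /(congr1 val) /= klbc.
  have [kl bc] : k = l /\ b = c by case: b c klbc => -[] /=; lia.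
  by congr pair; first exact: val_inj.
have pB : bijective p.
  by apply: inj_card_bij pI _; rewrite card_prod card_bool !card_ord mulnC.
pose u (i : 'I_(2 * n)) := i%:R * h / 2.
pose O := [set p (k, true) | k : 'I_n]%SET.
have pTI : injective (fun k => p (k, true)) by move=> k l /pI [].
have cardO : #|O| = n by rewrite card_imset // card_ord.
pose Q (B : {set 'I_(2 * n)}) :=
  f ((\sum_(i in B) i)%N%:R * h - 'C(2 * n, 2)%:R * h / 2).
rewrite /weight /Qset size_permutations ?iota_uniq // size_iota.
rewrite sum_permutations_iota.
transitivity ((2 * n)`!%:R^-1 * \sum_(s : 'S_(2 * n)) Q (s @: O)); last first.
  have := sum_imset_perm O Q; rewrite cardO card_ord => eqQ.
  have C0 : 'C(2 * n, n)%:R != 0 :> R.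
    by rewrite pnatr_eq0 -lt0n bin_gt0; lia.
  have F0 : (2 * n)`!%:R != 0 :> R by rewrite pnatr_eq0 -lt0n fact_gt0.
  apply: (mulfI C0); apply: (mulfI F0).
  by rewrite mulrCA mulVKf // eqQ mulVKf.
congr (_ * _).
(* The accumulator starts at 0, where [f] is 1, so it adds no factor on the left. *)
have := @sum_perm_prod _ f _ _ u p (fun=> 0) (index_enum 'I_n) fD pI
  (index_enum_uniq _) (fun _ _ _ => erefl).
under eq_bigr do rewrite f0 mul1r.
under [RHS]eq_bigr do rewrite add0r.
move=> eqS; transitivity (\sum_(s : 'S_(2 * n))
    \prod_(k < n) f (u (s (p (k, true))) - u (s (p (k, false))))).
  apply: eq_bigr => s _; rewrite big_add1 big_mkord; apply: eq_bigr => k _.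
  have entE kb :
      ent [seq (s i).+1 | i <- enum 'I_(2 * n)] (p kb).+1 = (s (p kb)).+1.
    rewrite /ent -[X in nth _ _ X]/(nat_of_ord (p kb)).
    by rewrite (nth_map (p kb)) ?size_enum_ord // nth_ord_enum.
  have -> : (2 * k.+1 = (p (k, true)).+1)%N by rewrite /=; lia.
  have -> : ((p (k, true)).+1.-1 = (p (k, false)).+1)%N by rewrite /=; lia.
  rewrite !entE !xE ?ltn_ord // /u -!natr1.
  by congr f; field.
rewrite eqS; apply: eq_bigr => s _; congr f.
have -> : (\sum_(i in s @: O) i)%N = (\sum_(k < n) s (p (k, true)))%N.
  rewrite big_imset /=; last by move=> ? ? _ _; apply: perm_inj.
  by rewrite big_imset //= => ? ? _ _; apply: pTI.
have tot : \sum_(k < n) (u (s (p (k, true))) + u (s (p (k, false)))) =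
    'C(2 * n, 2)%:R * h / 2.
  rewrite -bin2_sum natr_sum !mulr_suml big_mkord.
  rewrite -/(\sum_i u i) (reindex_inj (@perm_inj _ s)) /= (reindex p) /=;
    last exact: onW_bij.
  transitivity (\sum_(k < n) \sum_(b : bool) u (s (p (k, b)))).
    by apply: eq_bigr => k _; rewrite big_bool.
  by rewrite pair_bigA; apply: eq_bigr => -[].
rewrite -tot natr_sum mulr_suml -sumrB; apply: eq_bigr => k _.
by rewrite /u; field.
Qed.

(** * Folding by complements and final assembly *)

(** Complementation swaps the sets with and without [ord0] and preserves [G] by symmetry, whence the
    factor 2. [N] is a variable so that the ordinal type can be rewritten to the successor form
    needed to split off [ord0]. *)
Lemma sum_half_subsets_rho (R : pzRingType) (m N : nat) (G : nat -> R) :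
  N = (2 * m.+1)%N -> (forall s t, (s + t)%N = 'C(N, 2) -> G s = G t) ->
  \sum_(B : {set 'I_N} | #|B| == m.+1) G (\sum_(i in B) i)%N =
  2 * \sum_(i < (m.+1 * m).+1) (rho i m m.+1)%:R * G ('C(m.+1, 2) + i)%N.
Proof.
move=> eqN; have {eqN} -> : N = (m + m.+1).+1 by lia.
move=> symG; rewrite (bigID (fun B : {set _} => ord0 \in B)) /=.
rewrite [X in _ + X](_ : _ = \sum_(B : {set 'I_(m + m.+1).+1} |
    (#|B| == m.+1) && (ord0 \in B)) G (\sum_(i in B) i)%N); last first.
  rewrite (reindex_inj (@finset.setC_inj _)); apply: eq_big => B.
    rewrite !inE negbK; congr (_ && _).
    have cB : (#|B| + #|~: B| = m.+1 + m.+1)%N by rewrite cardsC card_ord.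
    by apply/eqP/eqP => e; move: cB; rewrite e; [move/addIn | move/addnI].
  move=> _; apply: symG; rewrite -bin2_sum big_mkord.
  rewrite [RHS](bigID (fun i => i \in B)) /= addnC; congr addn.
  by apply: eq_bigl => i; rewrite inE.
rewrite -[LHS]mulr2n -[LHS]mulr_natl; congr (_ * _).
rewrite sum_split_ord0; under [LHS]eq_bigl do rewrite card_lift0 eqSS.
under [LHS]eq_bigr => A /eqP cA do rewrite sum_lift0 cA.
rewrite (sum_subsets_rho (fun s => G (m + s)%N) (K := (m.+1 * m).+1));
  last by lia.
by apply: eq_bigr => i _; congr (_ * G _); rewrite binS bin1; lia.
Qed.

Lemma weight_rho (R : realType) (f : R -> R) (x : int -> R) (j : int)
    (n : nat) (h : R) : (0 < n)%N ->
  (forall s t, f (s + t) + f (s - t) = 2 * (f s * f t)) -> f 0 = 1 ->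
  (forall k : nat, (1 <= k <= 2 * n)%N -> x (j + k%:Z) = x j + k%:R * h) ->
  weight f x j n = (size (Sset n))%:R^-1 *
    \sum_(0 <= i < (n * (n - 1)).+1)
      (rho i (n - 1) n)%:R * f (((n ^ 2)%:R - (2 * i)%:R) / 2 * h).
Proof.
case: n => // m _ fD f0 xE.
(* Evenness is d'Alembert's equation at s = 0. *)
have fN t : f (- t) = f t.
  by have := fD 0 t; rewrite add0r sub0r f0 mul1r; lra.
rewrite (weight_subsets fD f0 xE).
have sizeS : size (Sset m.+1) = 'C(m + m.+1, m) by exact: size_permutations_nseq.
(* This 2 cancels the one produced by folding. *)
have binE : 'C(2 * m.+1, m.+1) = (2 * 'C(m + m.+1, m))%N.
  have -> : (2 * m.+1 = (m + m.+1).+1)%N by lia.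
  by rewrite binS -(@bin_sub _ m) ?leq_addr // addKn addnn mul2n.
have bin2E k : 'C(k.+1, 2)%:R = k.+1%:R * k%:R / 2 :> R.
  have := mul_bin_diag k.+1 1; rewrite bin1 => /(congr1 (fun i => i%:R : R)).
  by rewrite !natrM => ->; field.
rewrite (@sum_half_subsets_rho _ m _
  (fun s => f (s%:R * h - 'C(2 * m.+1, 2)%:R * h / 2))) //; last first.
  move=> s t /(congr1 (fun i => i%:R : R)); rewrite natrD => <-.
  by rewrite -fN; congr f; field.
rewrite sizeS binE natrM invfM mulrACA mulVf ?pnatr_eq0 // mul1r.
rewrite subn1 /= big_mkord; congr (_ * _); apply: eq_bigr => i _; congr (_ * _).
(* With n = m + 1, n(n-1)/2 + i - n(2n-1)/2 = -(n^2 - 2i)/2; evenness removes the sign. *)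
rewrite -fN; congr f; rewrite natrD (_ : 2 * m.+1 = (2 * m).+2)%N; last by lia.
rewrite !bin2E natrX -[(2 * m).+2%:R]natr1 -[(2 * m).+1%:R]natr1 -[m.+1%:R]natr1.
by rewrite !natrM; field.
Qed.

(* I is the index range of the knot sequence: finite, one-sided or two-sided. *)
Theorem theorem3p2 (R : realType) (n : nat) (hn : (1 <= n)%N)
    (I : interval int) (x : int -> R)
    (hx : forall i k : int, i \in I -> k \in I -> i <= k -> x i <= x k)
    (j : int)
    (hI : forall k : nat, (k <= 2 * n + 1)%N -> j + k%:Z \in I)
    (h : R) (hpos : 0 < h)
    (hunif : forall k : nat, (1 <= k <= 2 * n + 1)%N ->
       x (j + k%:Z) = x j + k%:R * h) :
  ((forall i : int, i \in I -> i + (2 * n + 1)%:Z \in I ->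
      x (i + (2 * n + 1)%:Z) - x i < pi) ->
    wT x j n =
      (size (Sset n))%:R^-1 *
      \sum_(0 <= i < (n * (n - 1)).+1)
        (rho i (n - 1) n)%:R * cos (((n ^ 2)%:R - (2 * i)%:R) / 2 * h)) /\
  wH x j n =
    (size (Sset n))%:R^-1 *
    \sum_(0 <= i < (n * (n - 1)).+1)
      (rho i (n - 1) n)%:R * cosh (((n ^ 2)%:R - (2 * i)%:R) / 2 * h).
Proof.
have hunif' (k : nat) : (1 <= k <= 2 * n)%N -> x (j + k%:Z) = x j + k%:R * h.
  by move=> hk; apply: hunif; lia.
split=> [_|]; apply: weight_rho => //.
- by move=> s t; rewrite cosD cosB; ring.
- exact: cos0.
- by move=> s t; rewrite /cosh !opprD !opprK !expRD; field.
- by rewrite /cosh oppr0 expR0; field.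
Qed.
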